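(* Let $a,b,c\in\mathbb{N}$, and let $f(x)\in\mathbb{Z}[x]$ be either a nonzero polynomial with nonnegative coefficients $\le b-1$, where $b\ge 2$ and $f(b)=c$, or $f(x)=(x^c-1)/(x-1)$ (in which case we set $b=1$). Then $f(x)=f_c^{(b)}(x)$, and the following hold: (1) If $c=p$, a prime, then $f_c^{(b)}$ is a PPI-polynomial for all $b\ge 1$. (2) (Descent) To convert $f(x)=f_c^{(b)}(x)$ into $f_c^{(b-a)}(x)$, where $b-a\in\mathbb{N}$ as well, follow these steps: (a) Substitute $x+a$ for $x$ and expand $f(x+a)$ in powers of $x$. This polynomial will have all positive coefficients. The indeterminate $x$ now represents the base $b-a$. (b) If all coefficients of the new polynomial are strictly less than $b-a$, stop. Otherwise, proceed to the next step. (If $b-a=1$, then the stopping point is reached when all coefficients are $1$.) (c) Replace all coefficients by their base-$(b-a)$ expansions; substitute $x$ for each $b-a$; simplify. Go to Step (b). (3) (Ascent) To convert $f(x)=f_c^{(b)}(x)$ into $f_c^{(b+a)}(x)$, follow these steps: (a) Substitute $x-a$ for $x$ and simplify $f(x-a)$. The indeterminate $x$ now represents the base $b+a$. (b) Convert the positive part of each coefficient to base $b+a$; substitute $x$ for $b+a$; simplify. (c) If the absolute value of each coefficient in the new polynomial is strictly less than $b+a$, go on to the next step. Otherwise, return to Step (b). (d) Write the polynomial in base $x$; replace any digit of the form $x-j$ by $b+a-j$; simplify. (4) The ascent and descent procedures are inverses of each other. (5) If $1\le b<b'$ and $b\le c$, then $f_c^{(b)}>f_c^{(b')}$. For $b>c$,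 both polynomial representatives are equal to the constant $c$.
   Context: $\mathbb{N}$ is the set of positive integers. For $c\in\mathbb{N}$, the polynomial representative of $c$ in base $1$ is $f_c^{(1)}(x)=\frac{x^c-1}{x-1}=x^{c-1}+\cdots+x+1$; for $b\in\mathbb{N}$ with $b\ge 2$, if $c=[a_k\cdots a_1a_0]_b=\sum_{i=0}^k a_ib^i$ is the unique base-$b$ expansion of $c$ (digits $a_i$ between $0$ and $b-1$), the polynomial representative of $c$ in base $b$ is $f_c^{(b)}(x)=a_kx^k+\cdots+a_1x+a_0$. A non-constant polynomial in $\mathbb{Z}[x]$ is proper if its values at integers are relatively prime (constant polynomials are not called proper); a polynomial in $\mathbb{Z}[x]$ is positive if its leading coefficient is positive; a PPI-polynomial is a positive, proper polynomial that is irreducible in $\mathbb{Z}[x]$. Every positive polynomial has a unique base-$x$ representation $\sum_{i=0}^m b_i(x)x^i$ with digits $b_i(x)\in\{0,1,2,\dots\}\cup\{x-1,x-2,\dots\}$ and $b_m(x)\neq 0$; ''writing in base $x$'' means passing to this representation. For $f,g\in\mathbb{Z}[x]$, $f>g$ means that $f-g$ is positive. Illustration of ascent step (b): going from base $2$ to base $3$ for $c=17$, $f_{17}^{(2)}(x-1)=x^4-4x^3+6x^2-4x+2$, and one replaces $4$ by $x+1$ and $6$ by $2x$ (so the coefficient $-4$ becomes $-(x+1)$).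
   Formalization: In (1), for b > p the representative is the constant p, which is not proper, so PPI is claimed for b ≤ p and only positivity and irreducibility for b > p; in (5), c > 1 is added to the strict inequality, since for b = c = 1 both representatives equal 1. *)

(* Defs.v *)
From HB Require Import structures.
From mathcomp Require Export all_boot all_order all_algebra.

Set Implicit Arguments.
Unset Strict Implicit.
Unset Printing Implicit Defensive.

Import Order.TTheory GRing.Theory Num.Theory.
Local Open Scope ring_scope.

Definition base_digit (b c i : nat) : nat := (c %/ b ^ i %% b)%N.

(* Digits of index >= c vanish, since c < b ^ c when b >= 2. The value at b = 0
   is junk. *)
Definition polyrep (b c : nat) : {poly int} :=
  if b == 1%N then \poly_(i < c) 1 else \poly_(i < c) (base_digit b c i)%:Z.

Definition poly_positive (f : {poly int}) : bool := 0 < lead_coef f.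

Definition poly_gt (f g : {poly int}) : bool := poly_positive (f - g).

Definition poly_proper (f : {poly int}) : Prop :=
  (1 < size f)%N /\
  forall d : int, (forall n : int, (d %| f.[n])%Z) -> d \is a GRing.unit.

(* Irreducibility in the ring Z[x]. The library's irreducible_poly ignores
   constant factors, hence is irreducibility over the fraction field. *)
Definition poly_irreducibleZ (f : {poly int}) : Prop :=
  [/\ f != 0, f \isn't a GRing.unit &
      forall g h : {poly int}, f = g * h ->
        g \is a GRing.unit \/ h \is a GRing.unit].

Definition PPI (f : {poly int}) : Prop :=
  [/\ poly_positive f, poly_proper f & poly_irreducibleZ f].

(* Replace every coefficient by its base-d expansion and write x for d. A
   negative coefficient keeps its sign and its absolute value is expanded: for
   d = 3, the coefficient -4 becomes -(x + 1). *)
Definition reexpand (d : nat) (g : {poly int}) : {poly int} :=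
  \sum_(i < size g) sgz g`_i *: (polyrep d (absz g`_i) * 'X^i).

(* repeat_until stop step g h: the loop "while stop fails, apply step", started
   at g, terminates and returns h. *)
Inductive repeat_until (stop : pred {poly int}) (step : {poly int} -> {poly int}) :
    {poly int} -> {poly int} -> Prop :=
| RepeatStop g : stop g -> repeat_until stop step g g
| RepeatStep g h : ~~ stop g -> repeat_until stop step (step g) h ->
    repeat_until stop step g h.

(* The coefficients of g are those of index < size g, so for d = 1 a zero
   coefficient below the leading one prevents stopping. *)
Definition descent_stop (d : nat) (g : {poly int}) : bool :=
  all (fun e : int => if d == 1%N then e == 1 else e < d%:Z) g.

(* descent a d f h: the descent procedure that lowers the base by a, to the new
   base d, halts on input f with output h. *)
Definition descent (a d : nat) (f h : {poly int}) : Prop :=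
  repeat_until (descent_stop d) (reexpand d) (f \Po ('X + (a%:Z)%:P)) h.

Definition ascent_stop (d : nat) (g : {poly int}) : bool :=
  all (fun e : int => `|e| < d%:Z) g.

(* The digits allowed in base x: 0, 1, 2, ... and x - 1, x - 2, ... *)
Definition xdigit (u : {poly int}) : Prop :=
  (exists n : nat, u = (n%:Z)%:P) \/
  (exists2 j : nat, (0 < j)%N & u = 'X - (j%:Z)%:P).

(* A base-x representation \sum_(i <= m) b_i(x) x^i of g is encoded as the
   polynomial r with coefficients r`_i = b_i in Z[x], the base x being
   substituted for its outer variable; b_m != 0 is the normal form of r. *)
Definition base_x_rep (g : {poly int}) (r : {poly {poly int}}) : Prop :=
  (forall i, xdigit r`_i) /\ g = r.['X].

(* Evaluating a digit at d turns x - j into d - j and leaves constants as they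
   are. *)
Definition replace_xdigits (d : nat) (r : {poly {poly int}}) : {poly int} :=
  \poly_(i < size r) (r`_i).[d%:Z].

(* ascent a d f h: the ascent procedure that raises the base by a, to the new
   base d, halts on input f with output h. Here the conversion step is performed
   at least once, as the test comes after it. *)
Definition ascent (a d : nat) (f h : {poly int}) : Prop :=
  exists2 g : {poly int},
    repeat_until (ascent_stop d) (reexpand d)
      (reexpand d (f \Po ('X - (a%:Z)%:P))) g &
    exists2 r : {poly {poly int}}, base_x_rep g r & h = replace_xdigits d r.

(* Main.v *)
(** A polynomial with coefficients of absolute value less than d has the sign of
    its leading coefficient at d, so a polynomial with coefficients in [0, d - 1]
    is determined by its value at d. Every step of the descent and ascent
    procedures preserves the value at the new base d, so the outcome is the
    representative of c as soon as the loop terminates. For d >= 2 it does because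
    expanding a coefficient that is at least d in absolute value decreases the sum
    of absolute values of the coefficients. For d = 1 the value of the derivative
    at 1 strictly increases and stays at most c ^ 2. The same sign principle,
    applied to the difference of two representatives at the larger base, gives (5).

    For (1) with b >= 2, a Horner-scheme estimate shows that the complex roots of a
    polynomial with digits in [0, b - 1] have real part less than b - 1/2. Hence a
    non-constant factor g satisfies |g(b)| > |g(b - 1)| >= 1, whereas one of two
    factors must have absolute value 1 at b when f(b) is prime. For b = 1,
    Eisenstein's criterion applies to f(x + 1). *)

Require Import Defs.
From mathcomp Require Import all_boot all_order all_algebra.
From mathcomp Require Import algC zify ring.

Set Implicit Arguments.
Unset Strict Implicit.
Unset Printing Implicit Defensive.

Import Order.TTheory GRing.Theory Num.Theory.
Local Open Scope ring_scope.

(** * Digits and values *)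

Lemma coefMXaddC0 (R : nzSemiRingType) (p : {poly R}) c :
  (p * 'X + c%:P)`_0 = c.
Proof. by rewrite coefD coefMX coefC add0r. Qed.

Lemma coefMXaddCS (R : nzSemiRingType) (p : {poly R}) c i :
  (p * 'X + c%:P)`_i.+1 = p`_i.
Proof. by rewrite coefD coefMX coefC addr0. Qed.

Lemma lead_coefMXaddC (R : nzSemiRingType) (p : {poly R}) c :
  p != 0 -> lead_coef (p * 'X + c%:P) = lead_coef p.
Proof.
move=> p0; rewrite /lead_coef size_MXaddC (negPf p0) /=.
by rewrite -(prednK (n := size p)) ?size_poly_gt0 // coefMXaddCS.
Qed.

Lemma horner_ge0 (p : {poly int}) x :
  (forall i, 0 <= p`_i) -> 0 <= x -> 0 <= p.[x].
Proof.
move=> p_ge0 x_ge0; rewrite horner_coef.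
by apply: sumr_ge0 => i _; rewrite mulr_ge0 ?exprn_ge0.
Qed.

Lemma horner_gt0 (p : {poly int}) x :
  (forall i, 0 <= p`_i) -> p != 0 -> 0 < x -> 0 < p.[x].
Proof.
elim/poly_ind: p => [|p c IHp] p_ge0; first by rewrite eqxx.
have c_ge0 : 0 <= c by have := p_ge0 0; rewrite coefMXaddC0.
have {}p_ge0 i : 0 <= p`_i by have := p_ge0 i.+1; rewrite coefMXaddCS.
rewrite hornerMXaddC; have [-> | p0] := eqVneq p 0.
  by rewrite horner0 !mul0r !add0r polyC_eq0 => c0 _; lia.
by move=> _ x0; have := IHp p_ge0 p0 x0; nia.
Qed.

Lemma horner_lt (p : {poly int}) x y :
  (forall i, 0 <= p`_i) -> (1 < size p)%N -> 0 < x -> x < y -> p.[x] < p.[y].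
Proof.
move=> p_ge0 sp x0 xy; have y0 : 0 < y by lia.
elim/poly_ind: p p_ge0 sp => [|p c IHp] p_ge0; first by rewrite size_poly0.
rewrite size_MXaddC.
have {}p_ge0 i : 0 <= p`_i by have := p_ge0 i.+1; rewrite coefMXaddCS.
have [-> | p0] := eqVneq p 0; first by rewrite size_poly0; case: (c == 0).
rewrite /= ltnS => _; rewrite !hornerMXaddC.
have := horner_gt0 p_ge0 p0 x0.
have [/eqP/size_poly1P[e _ ->] | sp] := eqVneq (size p) 1%N.
  by rewrite !hornerC; nia.
have: p.[x] < p.[y].
  by apply: IHp => //; rewrite ltn_neqAle eq_sym sp size_poly_gt0.
by nia.
Qed.

(** By Horner's rule: a positive integer value at [d] is at least 1, so its product with [d]
    outweighs a constant coefficient of modulus below [d]. *)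
Lemma horner_gt0_lead (d : int) (p : {poly int}) :
  (forall i, `|p`_i| < d) -> 0 < lead_coef p -> 0 < p.[d].
Proof.
elim/poly_ind: p => [|p c IHp] p_lt; first by rewrite lead_coef0.
have c_lt : `|c| < d by have := p_lt 0; rewrite coefMXaddC0.
have {}p_lt i : `|p`_i| < d by have := p_lt i.+1; rewrite coefMXaddCS.
rewrite hornerMXaddC; have [-> | p0] := eqVneq p 0.
  by rewrite horner0 !mul0r !add0r lead_coefC; lia.
by rewrite lead_coefMXaddC // => /(IHp p_lt); nia.
Qed.

Lemma lead_gt0_horner (d : int) (p : {poly int}) :
  (forall i, `|p`_i| < d) -> 0 < p.[d] -> 0 < lead_coef p.
Proof.
move=> p_lt; have [->|p0] := eqVneq p 0; first by rewrite horner0.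
have : lead_coef p != 0 by rewrite lead_coef_eq0.
have pN_lt i : `|(- p)`_i| < d by rewrite coefN normrN.
case: (ltrgt0P (lead_coef p)) => // lc0 _ pd.
have := horner_gt0_lead pN_lt; rewrite lead_coefN hornerN !oppr_gt0 => /(_ lc0).
by rewrite ltNge (ltW pd).
Qed.

Lemma digits_inj (d : int) (p q : {poly int}) :
  (forall i, 0 <= p`_i < d) -> (forall i, 0 <= q`_i < d) ->
  p.[d] = q.[d] -> p = q.
Proof.
move=> hp hq e; apply/eqP; rewrite -subr_eq0 -lead_coef_eq0.
have h1 i : `|(p - q)`_i| < d.
  by rewrite coefB; move: (p`_i) (q`_i) (hp i) (hq i) => u v; lia.
have h2 i : `|(q - p)`_i| < d.
  by rewrite coefB; move: (p`_i) (q`_i) (hp i) (hq i) => u v; lia.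
have := horner_gt0_lead h1; have := horner_gt0_lead h2.
rewrite -(opprB p q) lead_coefN oppr_gt0 !hornerE e subrr oppr0 ltxx.
by case: (ltrgt0P (lead_coef _)) => // _ h h'; [have := h' isT | have := h isT].
Qed.

Lemma sum_base_digits b c k :
  (\sum_(i < k) base_digit b c i * b ^ i)%N = (c %% b ^ k)%N.
Proof.
elim: k => [|k IHk]; first by rewrite big_ord0 expn0 modn1.
rewrite big_ord_recr IHk /= /base_digit modn_divl -expnS addnC.
by rewrite [RHS](divn_eq _ (b ^ k)) modn_dvdm // dvdn_exp2l.
Qed.

Lemma coef_polyrep1 c i : (polyrep 1 c)`_i = (i < c)%:Z.
Proof. by rewrite /polyrep eqxx coef_poly; case: ltnP. Qed.

Lemma polyrep_coef_ge0 b c i : 0 <= (polyrep b c)`_i.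
Proof. by rewrite /polyrep; case: eqP => _; rewrite coef_poly; case: ifP. Qed.

Lemma polyrep_coef_lt b c i : (1 < b)%N -> (polyrep b c)`_i < b%:Z.
Proof.
move=> b1; rewrite /polyrep; case: eqP => [|_]; first by lia.
rewrite coef_poly; case: ifP => _; last by lia.
by rewrite ltz_nat ltn_pmod //; lia.
Qed.

Lemma polyrep_horner b c : (0 < b)%N -> (polyrep b c).[b%:Z] = c%:Z.
Proof.
move=> b0; rewrite /polyrep; case: eqP => [->|/eqP b1]; rewrite horner_poly.
  under eq_bigr do rewrite expr1n mulr1.
  by rewrite sumr_const card_ord natz.
(* As [c < b ^ c], cutting off after [c] digits loses nothing. *)
rewrite -[in RHS](modn_small (m := c) (d := b ^ c)%N); last first.
  by rewrite ltn_expl //; lia.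
rewrite -sum_base_digits -[RHS]natz natr_sum; apply: eq_bigr => i _.
by rewrite natrM natrX !natz.
Qed.

Lemma eq_polyrep b c (p : {poly int}) : (1 < b)%N ->
  (forall i, 0 <= p`_i < b%:Z) -> p.[b%:Z] = c%:Z -> p = polyrep b c.
Proof.
move=> b1 hp e; apply: (@digits_inj b%:Z) => // [i|].
  by rewrite polyrep_coef_ge0 polyrep_coef_lt.
by rewrite e polyrep_horner //; lia.
Qed.

Lemma polyrep_eq0 b c : (0 < b)%N -> (polyrep b c == 0) = (c == 0%N).
Proof.
move=> b0; apply/eqP/eqP => [e | ->].
  by have := polyrep_horner c b0; rewrite e horner0; lia.
by rewrite /polyrep; case: eqP => _; apply/polyP => i; rewrite coef_poly coef0.
Qed.

Lemma polyrep_small b c : (c < b)%N -> (0 < c)%N -> polyrep b c = (c%:Z)%:P.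
Proof.
move=> cb c0; apply/esym/eq_polyrep; rewrite ?hornerC //; first by lia.
by move=> i; rewrite coefC; case: eqP; lia.
Qed.

Lemma size_polyrep1 c : size (polyrep 1 c) = c.
Proof.
rewrite /polyrep eqxx; case: c => [|c]; first by rewrite poly_def big_ord0 size_poly0.
by rewrite size_poly_eq.
Qed.

Lemma size_polyrep_gt1 b c : (1 < c)%N -> (0 < b <= c)%N ->
  (1 < size (polyrep b c))%N.
Proof.
move=> c1 /andP[b0 bc]; have [->|b1] := eqVneq b 1%N; first by rewrite size_polyrep1.
rewrite ltnNge; apply/negP => /size1_polyC e.
have := polyrep_horner c b0; have := polyrep_coef_lt c 0 (b := b).
by rewrite e hornerC coefC /=; lia.
Qed.

Lemma polyrep1E c : ('X^c - 1) %/ ('X - 1) = polyrep 1 c.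
Proof.
(* Division in [{poly int}] is only pseudo-division in general; here it is exact because ['X - 1] is
   monic. *)
rewrite subrX1 mulrC -polyC1 Pdiv.IdomainUnit.mulpK; last first.
  by rewrite lead_coefXsubC unitr1.
rewrite /polyrep eqxx poly_def; apply: eq_bigr => i _; by rewrite scale1r.
Qed.

(** * Loops and re-expansion *)

Lemma repeat_until_inv stop step (inv : {poly int} -> Prop) g h :
  (forall p, inv p -> ~~ stop p -> inv (step p)) -> inv g ->
  repeat_until stop step g h -> inv h /\ stop h.
Proof.
move=> inv_step inv_g gh; elim: gh inv_g => [//|p q nsp _ IH inv_p].
exact/IH/inv_step.
Qed.

Lemma repeat_until_total stop step (inv : {poly int} -> Prop)
    (measure : {poly int} -> nat) g :
  (forall p, inv p -> ~~ stop p ->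
     inv (step p) /\ (measure (step p) < measure p)%N) ->
  inv g -> exists h, repeat_until stop step g h.
Proof.
move=> dec; have [n] := ubnP (measure g); elim: n g => // n IHn g lt_n inv_g.
have [sg | nsg] := boolP (stop g); first by exists g; apply: RepeatStop.
have [inv_s lt_s] := dec _ inv_g nsg.
have [|h ?] := IHn (step g) _ inv_s; first by apply: leq_trans lt_s _; rewrite -ltnS.
by exists h; apply: RepeatStep.
Qed.

(** At [d], the expansion of a coefficient [e] takes the value [sgz e * |e| = e], whatever its
    sign. *)
Lemma horner_reexpand d g : (0 < d)%N -> (reexpand d g).[d%:Z] = g.[d%:Z].
Proof.
move=> d0; rewrite horner_sum horner_coef; apply: eq_bigr => i _.
rewrite hornerZ hornerM hornerXn polyrep_horner // mulrA; congr (_ * _).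
by rewrite -intEsg.
Qed.

Lemma coef_reexpand_ge0 d (g : {poly int}) : (forall i, 0 <= g`_i) ->
  forall i, 0 <= (reexpand d g)`_i.
Proof.
move=> g_ge0 i; rewrite coef_sum; apply: sumr_ge0 => j _.
rewrite coefZ coefMXn mulr_ge0 //; first by rewrite sgz_ge0.
by case: ifP => // _; apply: polyrep_coef_ge0.
Qed.

(** Termination measure of both loops for [d >= 2]. *)
Definition l1norm (p : {poly int}) : nat := (\sum_(i < size p) absz (p`_i)%R)%N.

Lemma l1normE n (p : {poly int}) : (size p <= n)%N -> l1norm p = (\sum_(i < n) absz (p`_i)%R)%N.
Proof.
move=> sp; rewrite /l1norm -(subnKC sp) big_split_ord /=.
rewrite [X in (_ + X)%N]big1 ?addn0 // => i _.
by rewrite nth_default ?leq_addr.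
Qed.

Lemma l1normD p q : (l1norm (p + q) <= l1norm p + l1norm q)%N.
Proof.
rewrite (l1normE (size_polyD p q)) (l1normE (leq_maxl (size p) (size q))).
rewrite (l1normE (leq_maxr (size p) (size q))).
rewrite -big_split; apply: leq_sum => i _ /=; rewrite coefD.
by move: (p`_i) (q`_i) => u v; lia.
Qed.

Lemma l1norm0 : l1norm 0 = 0%N.
Proof. by rewrite /l1norm size_poly0 big_ord0. Qed.

Lemma l1norm_sum n (F : 'I_n -> {poly int}) :
  (l1norm (\sum_i F i) <= \sum_i l1norm (F i))%N.
Proof.
elim/big_ind2: _ => // [|p m q k pm qk]; first by rewrite l1norm0.
exact: leq_trans (l1normD _ _) (leq_add pm qk).
Qed.

Lemma l1normMXn (p : {poly int}) n : l1norm (p * 'X^n) = l1norm p.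
Proof.
have [->|p0] := eqVneq p 0; first by rewrite mul0r.
rewrite {1}/l1norm size_mulXn // big_split_ord /= big1 ?add0n => [|i _].
  by apply: eq_bigr => i _; rewrite coefMXn ltnNge leq_addr /= addKn.
by rewrite coefMXn ltn_ord.
Qed.

Lemma l1normZ_sgz (e : int) (p : {poly int}) : (l1norm (sgz e *: p) <= l1norm p)%N.
Proof.
rewrite !(@l1normE (size p)) ?size_scale_leq //.
by apply: leq_sum => i _; rewrite coefZ abszM; case: sgzP => _; rewrite ?mul0n ?mul1n.
Qed.

Lemma l1norm_horner1 (p : {poly int}) : (forall i, 0 <= p`_i) -> (l1norm p)%:Z = p.[1].
Proof.
move=> p_ge0; rewrite horner_coef -natz natr_sum; apply: eq_bigr => i _.
by rewrite expr1n mulr1 natz gez0_abs.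
Qed.

(** The norm is the value at 1 and [n] is the value at [d]; a non-constant polynomial with
    nonnegative coefficients increases strictly in between. *)
Lemma l1norm_polyrep_lt d n : (1 < d <= n)%N -> (l1norm (polyrep d n) < n)%N.
Proof.
move=> /andP[d1 dn]; rewrite -ltz_nat l1norm_horner1; last exact: polyrep_coef_ge0.
rewrite -(@polyrep_horner d n); last by lia.
by apply: horner_lt; rewrite ?size_polyrep_gt1 //; [exact: polyrep_coef_ge0|lia..].
Qed.

Lemma l1norm_polyrep d n : (1 < d)%N -> (l1norm (polyrep d n) <= n)%N.
Proof.
move=> d1; case: (ltnP n d) => [nd | dn]; last first.
  by rewrite ltnW // l1norm_polyrep_lt ?d1.
case: (posnP n) => [->|n0].
  by have /eqP-> : polyrep d 0 == 0; rewrite ?polyrep_eq0 ?l1norm0; lia.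
by rewrite polyrep_small // -lez_nat l1norm_horner1 ?hornerC // => -[|i];
  rewrite coefC.
Qed.

(** By the triangle inequality it suffices to treat the coefficients separately: none contributes
    more than before, and one that fails the test contributes strictly less. *)
Lemma l1norm_reexpand d g : (1 < d)%N -> ~~ ascent_stop d g ->
  (l1norm (reexpand d g) < l1norm g)%N.
Proof.
move=> d1 /allPn[e /(nthP 0)[k k_lt <-]] big_k.
apply: leq_ltn_trans (l1norm_sum _) _.
have term_le i :
    (l1norm (sgz g`_i *: (polyrep d (absz g`_i) * 'X^i))%R <=
     l1norm (polyrep d (absz g`_i)%R))%N.
  by apply: leq_trans (l1normZ_sgz _ _) _; rewrite l1normMXn.
rewrite /l1norm (bigD1 (Ordinal k_lt)) //= [X in (_ < X)%N](bigD1 (Ordinal k_lt)) //=.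
rewrite -addSn leq_add //.
  apply: leq_ltn_trans (term_le _) _; apply: l1norm_polyrep_lt.
  by move: big_k; move: (g`_k) => u; lia.
by apply: leq_sum => i _; apply: leq_trans (term_le _) _; apply: l1norm_polyrep.
Qed.

Lemma ascent_loop_total d g : (1 < d)%N ->
  exists h, repeat_until (ascent_stop d) (reexpand d) g h.
Proof.
move=> d1; apply: (@repeat_until_total _ _ (fun=> True) l1norm) => // p _ nsp.
by split=> //; apply: l1norm_reexpand.
Qed.

(** * Descent *)

Lemma size_comp_poly_addC (p : {poly int}) a :
  size (p \Po ('X + a%:P)) = size p.
Proof. by rewrite size_comp_poly2 // size_XaddC. Qed.

(** If [q] is the shift of [p], then [p * 'X + c] shifts to [q * 'X + a q + c]. Its coefficients are
    [a q_0 + c] and [q_i + a q_(i+1)], so positivity passes from [q] to it. *)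
Lemma coef_shift_gt0 (p : {poly int}) (a : int) : 0 < a ->
  (forall i, 0 <= p`_i) ->
  forall i, (i < size (p \Po ('X + a%:P)))%N -> 0 < (p \Po ('X + a%:P))`_i.
Proof.
move=> a0; elim/poly_ind: p => [|p c IHp] p_ge0 i.
  by rewrite comp_poly0 size_poly0.
have c_ge0 : 0 <= c by have := p_ge0 0; rewrite coefMXaddC0.
have {}p_ge0 j : 0 <= p`_j by have := p_ge0 j.+1; rewrite coefMXaddCS.
rewrite size_comp_poly_addC comp_polyD comp_polyM comp_polyX comp_polyC.
move: (p \Po _) (IHp p_ge0) (size_comp_poly_addC p a) => q q_gt0 sq.
rewrite size_MXaddC -size_poly_eq0 -sq size_poly_eq0.
have q_ge0 j : 0 <= q`_j.
  by case: (ltnP j (size q)) => [/q_gt0/ltW //| /(nth_default 0) ->].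
rewrite mulrDr !coefD coefMX coefMC coefC.
case: i => [|i] /=.
  have [->|q0] := eqVneq q 0; first by rewrite coef0 mul0r !add0r lt0r; case: eqP.
  have := q_gt0 0; rewrite size_poly_gt0 q0 => /(_ isT).
  by move: (q`_0) => u; nia.
case: ifP => // _; rewrite ltnS => /q_gt0; have := q_ge0 i.+1.
by move: (q`_i) (q`_i.+1) => u v; nia.
Qed.

(** The right-to-left direction contains termination: some output exists, and the invariant leaves
    only one candidate. On nonnegative coefficients the two stopping tests agree, so the norm serves
    as measure here too. *)
Lemma descent_loop_gt1 d c (g h : {poly int}) : (1 < d)%N ->
  (forall i, 0 <= g`_i) -> g.[d%:Z] = c%:Z ->
  repeat_until (descent_stop d) (reexpand d) g h <-> h = polyrep d c.
Proof.
move=> d1 g_ge0 gd; have d0 : (0 < d)%N by lia.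
pose inv (p : {poly int}) := (forall i, 0 <= p`_i) /\ p.[d%:Z] = c%:Z.
have inv_step p : inv p -> ~~ descent_stop d p -> inv (reexpand d p).
  by case=> p_ge0 pd _; split; [exact: coef_reexpand_ge0 | rewrite horner_reexpand].
have stopE p : inv p -> descent_stop d p = ascent_stop d p.
  case=> p_ge0 _; apply: eq_in_all => e /(nthP 0)[i _ <-].
  by case: eqP => [|_]; [lia | rewrite ger0_norm].
have uniq k : repeat_until (descent_stop d) (reexpand d) g k -> k = polyrep d c.
  case/(repeat_until_inv inv_step) => // -[k_ge0 kd] /allP sk.
  apply: eq_polyrep => // i; rewrite k_ge0 /=.
  case: (ltnP i (size k)) => [/(mem_nth 0)/sk | /(nth_default 0) ->]; last by lia.
  by case: eqP => //; lia.
split=> [/uniq // | ->].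
have [k gk] : exists k, repeat_until (descent_stop d) (reexpand d) g k.
  apply: (@repeat_until_total _ _ inv l1norm) => // p inv_p nsp.
  by split; [exact: inv_step | apply: l1norm_reexpand; rewrite -?stopE].
by rewrite -(uniq _ gk).
Qed.

Lemma horner_deriv1 (p : {poly int}) : p^`().[1] = \sum_(i < size p) p`_i *+ i.
Proof.
rewrite -{1}(coefK p) poly_def raddf_sum horner_sum; apply: eq_bigr => i _.
by rewrite /= derivZ derivXn hornerZ hornerMn hornerXn expr1n mulr_natr.
Qed.

(** Product rule at 1: the term [e x^i] becomes [x^i (1 + ... + x^(e-1))], which contributes [e i]
    plus the derivative of the second factor. The extra sum is the growth that makes the base-1 loop
    terminate. *)
Lemma horner_deriv_reexpand1 (p : {poly int}) : (forall i, 0 <= p`_i) ->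
  ((reexpand 1 p)^`()).[1] =
    p^`().[1] + \sum_(i < size p) (polyrep 1 (absz p`_i))^`().[1].
Proof.
move=> p_ge0; rewrite (horner_deriv1 p) raddf_sum horner_sum -big_split.
apply: eq_bigr => i _ /=; rewrite derivZ derivM derivXn hornerZ hornerD !hornerM.
rewrite hornerMn !hornerXn !expr1n.
rewrite (polyrep_horner _ (isT : (0 < 1)%N)) mulr1 mulrDr mulrA -intEsg mulr_natr.
rewrite addrC; congr (_ + _).
have [->|pi0] := eqVneq p`_i 0; first rewrite sgz0 mul0r.
  by have /eqP-> := polyrep_eq0 0 (isT : (0 < 1)%N); rewrite deriv0 horner0.
by rewrite gtr0_sgz ?mul1r // lt0r pi0 p_ge0.
Qed.

Lemma deriv_coef_ge0 (p : {poly int}) : (forall i, 0 <= p`_i) ->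
  forall i, 0 <= p^`()`_i.
Proof. by move=> p_ge0 i; rewrite coef_deriv mulrn_wge0. Qed.

Lemma coef_pred_gt0 (p : {poly int}) :
  (forall i, 0 < p`_i.+1 -> 0 < p`_i) ->
  forall i k, (i <= k)%N -> 0 < p`_k -> 0 < p`_i.
Proof.
move=> dcl i; elim=> [|k IHk]; first by rewrite leqn0 => /eqP->.
by rewrite leq_eqVlt => /predU1P[-> // | ik /dcl]; apply: IHk.
Qed.

(** In base 1 the coefficient at [j] becomes a block of ones on the indices from [j] to
    [j + p_j - 1]; the new coefficient at [i] counts the blocks that contain [i]. *)
Lemma coef_reexpand1_gt0 (p : {poly int}) i : (forall i, 0 <= p`_i) ->
  reflect (exists2 j, (j <= i)%N & i%:Z < j%:Z + p`_j) (0 < (reexpand 1 p)`_i).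
Proof.
move=> p_ge0; rewrite lt0r coef_reexpand_ge0 // andbT coef_sum.
have termE j : (sgz p`_j *: (polyrep 1 (absz p`_j) * 'X^j))`_i =
    ((j <= i)%N && (i%:Z < j%:Z + p`_j))%:Z.
  rewrite coefZ coefMXn ltnNge; case: leqP => /= [ji | _]; last by rewrite mulr0.
  rewrite coef_polyrep1; have [pj0|pj0] := eqVneq p`_j 0.
    by rewrite pj0 sgz0 mul0r addr0; case: ltP => //; lia.
  rewrite gtr0_sgz ?lt0r ?pj0 ?p_ge0 // mul1r; congr (nat_of_bool _)%:Z.
  by have := p_ge0 j; move: (p`_j) => u; lia.
rewrite psumr_neq0 => [|j _]; last by rewrite termE; case: (_ && _).
apply: (iffP hasP) => [[j _] | [j ji lt_i]].
  by rewrite termE /=; case: andP => // -[ji lt_i] _; exists j.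
have jp : (j < size p)%N.
  by rewrite ltnNge; apply: contraL lt_i => /(nth_default 0) ->; lia.
by exists (Ordinal jp); rewrite ?mem_index_enum //= termE ji lt_i.
Qed.

(** The support is kept free of gaps: an inner zero would prevent stopping, and positivity of all
    coefficients bounds the size by the value [c] at 1. *)
Lemma descent_loop1 c (g h : {poly int}) : (0 < c)%N ->
  (forall i, 0 <= g`_i) -> (forall i, 0 < g`_i.+1 -> 0 < g`_i) ->
  g.[1] = c%:Z ->
  repeat_until (descent_stop 1) (reexpand 1) g h <-> h = polyrep 1 c.
Proof.
move=> c0 g_ge0 g_dcl g1.
pose inv (p : {poly int}) := [/\ forall i, 0 <= p`_i,
   forall i, 0 < p`_i.+1 -> 0 < p`_i & p.[1] = c%:Z].
have inv_step p : inv p -> ~~ descent_stop 1 p -> inv (reexpand 1 p).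
  case=> p_ge0 dcl p1 _; split; [exact: coef_reexpand_ge0 | | ].
    (* A block containing [i + 1] also contains [i], unless it starts at [i + 1]; then [p_i] is
       positive as well and the block starting at [i] serves. *)
    move=> i /coef_reexpand1_gt0[] // j; rewrite leq_eqVlt => /predU1P[-> | ji] lt_i.
      apply/coef_reexpand1_gt0 => //; exists i => //.
      have: 0 < p`_i.+1 by move: lt_i; move: (p`_i.+1) => u; lia.
      by move/dcl; move: (p`_i) => u; lia.
    apply/coef_reexpand1_gt0 => //; exists j => //.
    by apply: lt_trans lt_i; rewrite ltz_nat.
  by rewrite (horner_reexpand p (isT : (0 < 1)%N)).
have pos p : inv p -> forall i, (i < size p)%N -> 0 < p`_i.
  case=> p_ge0 dcl p1 i ip; apply: (coef_pred_gt0 dcl (k := (size p).-1)); first by lia.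
  rewrite -/(lead_coef p) lt0r p_ge0 lead_coef_eq0 andbT.
  by apply: contraTneq ip => ->; rewrite size_poly0.
have size_le p : inv p -> (size p <= c)%N.
  move=> inv_p; case: (inv_p) => _ _ p1; rewrite -lez_nat -p1 horner_coef.
  rewrite -[leLHS]natz -[X in X%:R]card_ord -sumr_const ler_sum // => i _.
  by rewrite expr1n mulr1 -gtz0_ge1 pos.
have uniq k : repeat_until (descent_stop 1) (reexpand 1) g k -> k = polyrep 1 c.
  case/(repeat_until_inv inv_step) => // -[_ _ k1] /allP sk.
  have kE i : k`_i = (i < size k)%:Z.
    by case: ltnP => [/(mem_nth 0)/sk/eqP // | /(nth_default 0)].
  suff sz : size k = c by apply/polyP => i; rewrite kE coef_polyrep1 sz.
  apply/eqP; rewrite -eqz_nat -k1 horner_coef eq_sym.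
  under eq_bigr => i _ do rewrite expr1n mulr1 kE ltn_ord.
  by rewrite sumr_const card_ord natz.
split=> [/uniq // | ->].
have [k gk] : exists k, repeat_until (descent_stop 1) (reexpand 1) g k.
  (* The digit sum does not decrease in base 1, but the derivative at 1 grows. *)
  apply: (@repeat_until_total _ _ inv (fun p => c * c - absz (p^`().[1])))%N => //.
  move=> p inv_p nsp; have inv_s := inv_step _ inv_p nsp; split=> //.
  have [p_ge0 _ _] := inv_p.
  (* The derivative at 1 is the sum of the [i q_i], where every [i] is below [size q <= c] and the
     [q_i] add up to [c]. *)
  have le_cc q : inv q -> 0 <= (q^`()).[1] <= c%:Z * c%:Z.
    move=> inv_q; have [q_ge0 _ q1] := inv_q.
    rewrite horner_ge0 //=; last exact: deriv_coef_ge0.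
    have -> : c%:Z * c%:Z = q.[1] * c%:Z by rewrite q1.
    rewrite horner_deriv1 horner_coef mulr_suml ler_sum // => i _; rewrite expr1n mulr1 -mulr_natr natz.
    by rewrite ler_wpM2l // lez_nat ltnW // (leq_trans (ltn_ord i)) // size_le.
  have := le_cc _ inv_p; have := le_cc _ inv_s.
  suff : p^`().[1] < (reexpand 1 p)^`().[1].
    by move: (p^`().[1]) ((reexpand 1 p)^`().[1]) => u v; lia.
  rewrite horner_deriv_reexpand1 // ltrDl.
  have ge0 e : 0 <= (polyrep 1 e)^`().[1].
    by rewrite horner_ge0 //; apply/deriv_coef_ge0/polyrep_coef_ge0.
  (* A coefficient other than 1 is at least 2 by positivity, so its expansion is non-constant and
     has a positive derivative at 1. *)
  have /allPn[e /(nthP 0)[k k_lt <-]] := nsp; rewrite eqxx => k_neq1.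
  rewrite (bigD1 (Ordinal k_lt)) //= ltr_wpDr ?sumr_ge0 //.
  have k_gt1 : (1 < absz (p`_k)%R)%N.
    by have := pos p inv_p k k_lt; move: k_neq1; move: (p`_k) => u; lia.
  apply: horner_gt0 => //; first exact/deriv_coef_ge0/polyrep_coef_ge0.
  apply/eqP => /(congr1 (fun q : {poly int} => q`_0)).
  by rewrite coef_deriv coef_polyrep1 k_gt1 coef0.
by rewrite -(uniq _ gk).
Qed.

Lemma descentE a d c (f h : {poly int}) :
  (0 < a)%N -> (0 < d)%N -> (0 < c)%N ->
  (forall i, 0 <= f`_i) -> f.[(a + d)%N%:Z] = c%:Z ->
  descent a d f h <-> h = polyrep d c.
Proof.
move=> a0 d0 c0 f_ge0 fc; rewrite /descent.
have pos := coef_shift_gt0 (a0 : 0 < a%:Z) f_ge0.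
have fd : (f \Po ('X + (a%:Z)%:P)).[d%:Z] = c%:Z.
  by rewrite horner_comp hornerD hornerX hornerC -fc PoszD addrC.
move: (f \Po _) pos fd => g pos gd.
have g_ge0 i : 0 <= g`_i.
  by case: (ltnP i (size g)) => [/pos/ltW // | /(nth_default 0) ->].
have [d1 | d1] := eqVneq d 1%N; last by apply: descent_loop_gt1 => //; lia.
subst d; apply: descent_loop1 => // i gi; apply: pos.
by apply: ltnW; rewrite ltnNge; apply: contraL gi => /(nth_default 0) ->.
Qed.

(** * Ascent *)

(** A negative constant coefficient [c] is turned into the digit [x - |c|] by borrowing 1 from the
    remaining part [p]. The leading coefficient may be 0 because the borrow can exhaust a constant
    [p = 1]. *)
Lemma base_x_rep_exists (g : {poly int}) :
  0 <= lead_coef g -> exists r, base_x_rep g r.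
Proof.
have [n] := ubnP (size g); elim: n g => // n IHn.
have rep0 : exists r, base_x_rep 0 r.
  exists 0; split; last by rewrite horner0.
  by move=> i; left; exists 0%N; rewrite coef0.
(* This only splits off the constant coefficient; the induction is on the size, as the recursion may
   continue with [p - 1] instead of [p]. *)
elim/poly_ind => // p c _ sz lc.
have cons_rep u q : xdigit u -> p * 'X + c%:P = q * 'X + u ->
    (exists r, base_x_rep q r) -> exists r, base_x_rep (p * 'X + c%:P) r.
  move=> du -> [r [dr ->]]; exists (r * 'X + u%:P); split.
    by case=> [|i]; rewrite ?coefMXaddC0 ?coefMXaddCS.
  by rewrite hornerMXaddC.
have [c0 | c0] := lerP 0 c.
  apply: (cons_rep c%:P p) => //.
    by left; exists (absz c); rewrite gez0_abs.
  move: sz lc; have [-> // | p0] := eqVneq p 0.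
  rewrite size_MXaddC (negPf p0) /= lead_coefMXaddC // ltnS; exact: IHn.
have p0 : p != 0.
  apply: contraTneq lc => ->; rewrite mul0r add0r lead_coefC; lia.
apply: (cons_rep ('X - ((absz c)%:Z)%:P) (p - 1)).
- by right; exists (absz c) => //; lia.
- have -> : (absz c)%:Z = - c by lia.
  by rewrite polyCN; ring.
move: sz lc; rewrite size_MXaddC (negPf p0) /= lead_coefMXaddC // ltnS => sz lc.
have lc_gt0 : 0 < lead_coef p by rewrite lt0r lead_coef_eq0 p0.
apply: IHn.
  apply: leq_ltn_trans sz; rewrite (leq_trans (size_polyD _ _)) //.
  by rewrite size_polyN size_poly1 geq_max leqnn size_poly_gt0.
have [/eqP/size_poly1P[e _ pE] | sp] := eqVneq (size p) 1%N.
  by move: lc_gt0; rewrite pE -polyC1 -polyCB !lead_coefC; lia.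
rewrite lead_coefDl // size_polyN size_poly1 ltn_neqAle eq_sym sp.
by rewrite size_poly_gt0.
Qed.

Lemma size_xdigit u : xdigit u -> (size u <= 2)%N.
Proof.
case=> [[n ->] | [j _ ->]]; last by rewrite size_XsubC.
exact: leq_trans (size_polyC_leq1 _) _.
Qed.

(* The digit [x - j] at index [i - 1] carries a 1 into the coefficient of index [i]. *)
Lemma coef_horner_X (r : {poly {poly int}}) i :
  (forall j, (size (r`_j)%R <= 2)%N) ->
  (r.['X])`_i = r`_i`_0 + (if i is k.+1 then r`_k`_1 else 0).
Proof.
elim/poly_ind: r i => [|r u IHr] i sr.
  by rewrite horner0 !coef0; case: i => [|i]; rewrite ?coef0 ?addr0.
have {}IHr k := IHr k (fun j => eq_ind _ (fun v : {poly int} => (size v <= 2)%N)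
   (sr j.+1) _ (coefMXaddCS r u j)).
have su : (size u <= 2)%N by have := sr 0; rewrite coefMXaddC0.
rewrite hornerMXaddC coefD coefMX.
case: i => [|[|i]] /=; rewrite ?coefMXaddC0 ?coefMXaddCS ?addr0 ?add0r //.
- by rewrite IHr addr0.
by rewrite IHr (nth_default 0 (_ : size u <= i.+2)%N) ?addr0 // (leq_trans su).
Qed.

Lemma xdigit_bounds (d : int) (g : {poly int}) r : base_x_rep g r ->
  0 < d -> (forall i, `|g`_i| < d) -> forall i, 0 <= (r`_i).[d] < d.
Proof.
move=> [dr gE] d0 g_lt i.
have := g_lt i; rewrite gE coef_horner_X => [|j]; last exact/size_xdigit/dr.
(* [k] is the carry from the digit below. A digit [x - j] gives [j - k < d], hence [j <= d], and
   [d - j] is a base-[d] digit since [j > 0]. *)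
set k := (if i is _.+1 then _ else _).
have : 0 <= k <= 1.
  rewrite /k; case: (i) => // j; have [[n ->] | [n _ ->]] := dr j.
    by rewrite coefC.
  by rewrite coefB coefX coefC.
move: k => k.
have [[n ->] | [j j0 ->]] := dr i.
  by rewrite coefC hornerC /=; lia.
by rewrite coefB coefX coefC hornerXsubC /=; lia.
Qed.

Lemma coef_replace_xdigits d r i :
  (replace_xdigits d r)`_i = (r`_i).[d%:Z].
Proof.
rewrite coef_poly; case: ltnP => // /(nth_default 0) ->.
by rewrite horner0.
Qed.

Lemma horner_replace_xdigits d r : (replace_xdigits d r).[d%:Z] = r.['X].[d%:Z].
Proof.
rewrite horner_poly (horner_coef r) horner_sum; apply: eq_bigr => i _.
by rewrite hornerM hornerXn.
Qed.

Lemma ascentE a d c (f h : {poly int}) : (1 < d)%N -> (0 < c)%N ->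
  f.[d%:Z - a%:Z] = c%:Z -> ascent a d f h <-> h = polyrep d c.
Proof.
move=> d1 c0 fc; have d0 : (0 < d)%N by lia.
pose inv (p : {poly int}) := p.[d%:Z] = c%:Z.
have inv_step p : inv p -> ~~ ascent_stop d p -> inv (reexpand d p).
  by move=> pd _; rewrite /inv horner_reexpand.
have inv_start : inv (reexpand d (f \Po ('X - (a%:Z)%:P))).
  by rewrite /inv horner_reexpand // horner_comp hornerXsubC.
have stop_lt p : ascent_stop d p -> forall i, `|p`_i| < d%:Z.
  move=> /allP sp i; case: (ltnP i (size p)) => [/(mem_nth 0)/sp //|].
  by move=> /(nth_default 0) ->; rewrite normr0; lia.
have uniq k : ascent a d f k -> k = polyrep d c.
  case=> g /(repeat_until_inv inv_step)[] // gd /stop_lt g_lt [r gr ->].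
  apply: eq_polyrep => // [i|]; last by rewrite horner_replace_xdigits -(gr.2).
  by rewrite coef_replace_xdigits; apply: xdigit_bounds gr _ g_lt i; lia.
split=> [/uniq // | ->].
have [g fg] := ascent_loop_total (reexpand d (f \Po ('X - (a%:Z)%:P))) d1.
have [gd /stop_lt g_lt] := repeat_until_inv inv_step inv_start fg.
(* The loop leaves coefficients of modulus below [d] and the value [c > 0] at [d], so the leading
   coefficient is positive. *)
have [|r gr] := @base_x_rep_exists g.
  by apply/ltW/(lead_gt0_horner g_lt); rewrite gd; lia.
have asc : ascent a d f (replace_xdigits d r) by exists g => //; exists r.
by rewrite -(uniq _ asc).
Qed.

(** * Roots of polynomials with bounded digits *)

Section Roots.
Variable C : numClosedFieldType.
Implicit Types (z : C) (p : {poly int}).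

Local Notation toC := (map_poly (intr : int -> C)).

Lemma horner_intr_MXaddC p c z :
  (toC (p * 'X + c%:P)).[z] = (toC p).[z] * z + c%:~R.
Proof. by rewrite rmorphD rmorphM /= map_polyX map_polyC hornerMXaddC. Qed.

Lemma norm_le_ReMconj (t w : C) : `|t| ^+ 2 <= 'Re (w * t^*) -> `|t| <= `|w|.
Proof.
move=> le_t; have [->|t0] := eqVneq t 0; first by rewrite normr0.
have n0 : 0 < `|t| by rewrite normr_gt0.
rewrite -(ler_pM2r n0) -expr2; apply: le_trans le_t _.
by rewrite -[X in _ <= _ * X]norm_conjC -normrM (leif_Re_Creal _).1.
Qed.

Lemma ReMz (m : int) z : 'Re (m%:~R * z) = m%:~R * 'Re z.
Proof. exact: (ReMl (realz _ m)). Qed.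

Lemma Re_norm z n : 'Re (`|z| ^+ n) = `|z| ^+ n.
Proof. by apply/Creal_ReP; rewrite rpredX ?normr_real. Qed.

(** Project onto [z]: the real part of [(u z + v) z^*] is [u |z|^2 + v Re z >= |z|^2]. *)
Lemma norm_linear_ge (u v : int) z : 0 < u -> 0 <= v -> 0 <= 'Re z ->
  `|z| <= `|u%:~R * z + v%:~R|.
Proof.
move=> u0 v0 z0; apply: norm_le_ReMconj.
rewrite mulrDl -mulrA -normCK raddfD /= !ReMz Re_conj.
rewrite Re_norm -[leLHS]addr0 lerD //.
  by rewrite ler_peMl ?exprn_ge0 // ler1z; lia.
by rewrite mulr_ge0 // ler0z.
Qed.

(** Project onto [z^2]: the real part of the product with its conjugate is
    [u |z|^4 + v |z|^2 Re z + w Re (z^2)]. *)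
Lemma norm_quadratic_ge (u v w : int) z : 0 < u -> 0 <= v -> 0 <= w ->
  0 <= 'Re z -> 0 <= 'Re (z ^+ 2) ->
  `|z| ^+ 2 <= `|(u%:~R * z + v%:~R) * z + w%:~R|.
Proof.
move=> u0 v0 w0 z0 zz0; rewrite -normrX; apply: norm_le_ReMconj.
have -> : ((u%:~R * z + v%:~R) * z + w%:~R) * (z ^+ 2)^* =
   u%:~R * `|z ^+ 2| ^+ 2 + v%:~R * `|z| ^+ 2 * z^* + w%:~R * (z ^+ 2)^*.
  by rewrite !normCK rmorphXn /=; ring.
rewrite !raddfD /= -mulrA !ReMz Re_norm ReMl ?rpredX ?normr_real // !Re_conj.
rewrite -addrA -[leLHS]addr0 lerD //.
  by rewrite ler_peMl ?exprn_ge0 // ler1z; lia.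
by rewrite addr_ge0 // !mulr_ge0 ?exprn_ge0 // ler0z.
Qed.

(* Evaluating by Horner's rule, a partial value of modulus at least [r] stays so
   once [r * |z| - (b - 1) >= r]. *)
Lemma norm_horner_ge (b : int) n (r : C) z :
  (b - 1)%:~R <= r * (`|z| - 1) ->
  (forall p, (forall i, 0 <= p`_i < b) -> size p = n.+1 -> r <= `|(toC p).[z]|) ->
  forall p, (forall i, 0 <= p`_i < b) -> (n < size p)%N -> r <= `|(toC p).[z]|.
Proof.
move=> le_r base; elim/poly_ind => [|p c IHp] digs; first by rewrite size_poly0.
rewrite leq_eqVlt => /predU1P[/esym|]; first exact: base.
have c_dig : 0 <= c < b by have := digs 0; rewrite coefMXaddC0.
have {}/IHp IHp i : 0 <= p`_i < b by have := digs i.+1; rewrite coefMXaddCS.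
rewrite size_MXaddC; case: ifP => // _; rewrite ltnS => /IHp le_p.
rewrite horner_intr_MXaddC; apply: le_trans (lerB_normD _ _).
rewrite normrM -intr_norm.
have : (`|c|%:~R : C) <= (b - 1)%:~R by rewrite ler_int; lia.
move=> /le_trans/(_ le_r); rewrite mulrBr mulr1 lerBrDr => le_c.
rewrite lerBrDl; apply: le_trans le_c _.
by rewrite ler_wpM2r.
Qed.

(** The bound [Re z < b - 1/2] is doubled to keep integers. If it fails, then [|z| >= 3/2], and
    Horner's rule bounds the modulus of the value at [z] below by [|z|] or [|z|^2], so [z] is no
    root. *)
Lemma digits_root_Re (b : int) p z : 2 <= b -> (forall i, 0 <= p`_i < b) ->
  p != 0 -> root (toC p) z -> 'Re z *+ 2 < (2 * b - 1)%:~R.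
Proof.
move=> b2 digs p0 /rootP pz0.
have Rz2 : 'Re z *+ 2 \is Num.real by rewrite rpredMn ?Creal_Re.
have [// | le_z] := real_ltP Rz2 (realz _ (2 * b - 1)).
have le_z3 : 3 <= 'Re z *+ 2.
  by apply: le_trans le_z; rewrite (ler_int C 3); lia.
have z_gt0 : 0 < 'Re z by rewrite -(pmulrn_lgt0 _ (isT : (0 < 2)%N)) (lt_le_trans _ le_z3).
have zN := (leif_Re_Creal z).1; have N_gt0 := lt_le_trans z_gt0 zN.
have N3 : 3 <= `|z| *+ 2 by apply: le_trans le_z3 _; rewrite lerMn2r zN.
have base1 (q : {poly int}) : (forall i, 0 <= q`_i < b) -> size q = 2 -> `|z| <= `|(toC q).[z]|.
  elim/poly_ind: q => [|q v _] dq; first by rewrite size_poly0.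
  rewrite size_MXaddC; case: ifP => // _ [] /eqP/size_poly1P[u u0 ?]; subst q.
  have := dq 0; rewrite coefMXaddC0 => /andP[v0 _].
  have := dq 1%N; rewrite coefMXaddCS coefC /= => u_dig.
  rewrite horner_intr_MXaddC map_polyC hornerC.
  by apply: norm_linear_ge => //; [rewrite lt0r u0; case/andP: u_dig | exact: ltW].
have sp1 : (1 < size p)%N.
  rewrite ltnNge; apply/negP => /size1_polyC pE; move: pz0 p0.
  by rewrite pE map_polyC hornerC => /eqP; rewrite intr_eq0 polyC_eq0 => ->.
have neq0 r : 0 < r -> ~ r <= `|(toC p).[z]|.
  by move=> r0; rewrite pz0 normr0 => /(lt_le_trans r0); rewrite ltxx.
have R2 : 2 \is @Num.real C by rewrite realn.
have [N2 | N2] := real_leP R2 (normr_real z).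
  (* Here [|z| * (|z| - 1) >= b - 1], so the estimate starts in degree 1. *)
  exfalso; apply: (neq0 `|z| N_gt0); apply: (norm_horner_ge (b := b) (n := 1)) => //.
  (* The chain is [|z| (|z| - 1) >= 2 |z| - 2 >= 2 b - 3 >= b - 1]. *)
  apply: (@le_trans _ _ (2 * (`|z| - 1))); last first.
    by apply: ler_wpM2r => //; rewrite subr_ge0 (le_trans _ N2) // ler1n.
  have : (2 * b - 1)%:~R <= `|z| *+ 2 by apply: le_trans le_z _; rewrite lerMn2r zN.
  have -> : 2 * (`|z| - 1) = `|z| *+ 2 - 2 by ring.
  rewrite -(lerD2r (-2)); apply: le_trans.
  by rewrite -(intrB C (2 * b - 1) 2) ler_int; move: b2; clear; lia.
(* There remains b = 2 with 3/2 <= |z| < 2: then |z| * (|z| - 1) may be less than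
   1, but [Re (z ^ 2) >= 0], so the estimate can start in degree 2. *)
have bE : b = 2.
  have : (2 * b - 1)%:~R < (4%:~R : C).
    apply: le_lt_trans le_z (le_lt_trans (y := `|z| *+ 2) _ _).
      by rewrite lerMn2r zN.
    have -> : 4%:~R = 2 *+ 2 :> C by ring.
    by rewrite ltrMn2r.
  by rewrite ltr_int; move: b2; clear; lia.
(* Twice this real part is [(2 Re z)^2 - 2 |z|^2 >= 9 - 8]. *)
have zz_ge0 : 0 <= 'Re (z ^+ 2).
  have N4 : `|z| ^+ 2 <= 4.
    have -> : 4 = 2 ^+ 2 :> C by ring.
    by rewrite lerXn2r ?nnegrE ?ltW.
  have x9 : 9 <= ('Re z *+ 2) ^+ 2.
    have -> : 9 = 3 ^+ 2 :> C by ring.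
    by rewrite lerXn2r ?nnegrE ?mulrn_wge0 // ltW.
  rewrite expr2 ReM -(pmulrn_lge0 _ (isT : (0 < 2)%N)).
  have -> : ('Re z * 'Re z - 'Im z * 'Im z) *+ 2 = ('Re z *+ 2) ^+ 2 - `|z| ^+ 2 *+ 2.
    by rewrite normC2_Re_Im; ring.
  rewrite subr_ge0; apply: le_trans x9; apply: (@le_trans _ _ (4 *+ 2)).
    by rewrite lerMn2r N4.
  have -> : 4 *+ 2 = 8 :> C by ring.
  by rewrite ler_nat.
exfalso; have N2_gt0 : 0 < `|z| ^+ 2 by rewrite exprn_gt0.
(* From [|z| >= 3/2] the product is at least [9/4 * 1/2 = 9/8]; the factor 8 below clears the
   denominators. *)
have ge1 : 1 <= `|z| ^+ 2 * (`|z| - 1).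
  have h1 : 1 <= `|z| *+ 2 - 2 by rewrite lerBrDr (le_trans _ N3) // -natrD.
  have h2 : 9 <= (`|z| *+ 2) ^+ 2.
    have -> : 9 = 3 ^+ 2 :> C by ring.
    by rewrite lerXn2r ?nnegrE ?mulrn_wge0.
  rewrite -(ler_pMn2r (isT : (0 < 8)%N)); apply: (@le_trans _ _ (9 * 1)).
    by rewrite mulr1 ler_nat.
  have -> : `|z| ^+ 2 * (`|z| - 1) *+ 8 = (`|z| *+ 2) ^+ 2 * (`|z| *+ 2 - 2) by ring.
  by apply: ler_pM.
have [sp2 | sp2] := leqP (size p) 2.
  by apply: (neq0 `|z| N_gt0); apply: base1 => //; apply/eqP; rewrite eqn_leq sp2.
apply: (neq0 _ N2_gt0); apply: (norm_horner_ge (b := b) (n := 2)) => //.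
  by rewrite bE.
elim/poly_ind => [|q w _] dq; first by rewrite size_poly0.
rewrite size_MXaddC; case: ifP => // _ [] sq.
have := dq 0; rewrite coefMXaddC0 => /andP[w0 _].
have {}dq i : 0 <= q`_i < b by have := dq i.+1; rewrite coefMXaddCS.
rewrite horner_intr_MXaddC.
elim/poly_ind: q dq sq => [|q v _] dq; first by rewrite size_poly0.
rewrite size_MXaddC; case: ifP => // _ [] /eqP/size_poly1P[u u0 ?]; subst q.
have := dq 0; rewrite coefMXaddC0 => /andP[v0 _].
have := dq 1%N; rewrite coefMXaddCS coefC /= => u_dig.
rewrite horner_intr_MXaddC map_polyC hornerC.
by apply: norm_quadratic_ge => //; [rewrite lt0r u0; case/andP: u_dig | exact: ltW].
Qed.

(** Each root lies left of the midpoint of [b - 1] and [b], hence is closer to [b - 1]; multiply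
    these inequalities over the linear factors. *)
Lemma norm_horner_pred_lt (b : int) p : (1 < size p)%N ->
  (forall z, root (toC p) z -> 'Re z *+ 2 < (2 * b - 1)%:~R) ->
  `|p.[b - 1]| < `|p.[b]|.
Proof.
move=> sp p_root; rewrite -(ltr_int C) !intr_norm -!(horner_map intr) /=.
have p0 : toC p != 0.
  rewrite -size_poly_gt0 size_map_inj_poly ?intr0 //; first exact: ltnW.
  exact: intr_inj.
have [rs pE] := closed_field_poly_normal (toC p).
have lc0 : lead_coef (toC p) != 0 by rewrite lead_coef_eq0.
have rs_root z : z \in rs -> root (toC p) z.
  by rewrite pE rootZ // root_prod_XsubC.
have : (0 < size rs)%N.
  rewrite -ltnS -(size_prod_XsubC rs id) -(size_scale _ lc0) -pE.
  by rewrite size_map_inj_poly ?intr0 //; exact: intr_inj.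
rewrite pE !hornerZ !normrM ltr_pM2l ?normr_gt0 // !horner_prod !normr_prod.
move: rs_root; rewrite -has_predT => rs_root rs_ne.
rewrite big_seq [ltRHS]big_seq; apply: ltr_prod.
  by case/hasP: rs_ne => z z_rs _; apply/hasP; exists z.
move=> z /rs_root/p_root z_lt; rewrite normr_ge0 !hornerXsubC /=.
rewrite -ltr_sqr ?nnegrE // !normC2_Re_Im.
rewrite !raddfB /= !(Creal_ReP _ (realz _ _)) !(Creal_ImP _ (realz _ _)).
rewrite subr0 ltrD2r -subr_gt0.
have -> : (b%:~R - 'Re z) ^+ 2 - (b%:~R - 1 - 'Re z) ^+ 2 =
  (2 * b - 1)%:~R - 'Re z *+ 2.
  by rewrite rmorphB rmorphM /=; ring.
by rewrite subr_gt0.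
Qed.

End Roots.

(** * Irreducibility and properness *)

Lemma unitz_absz (n : int) : (n \is a GRing.unit) = (absz n == 1%N).
Proof.
have -> : (n \is a GRing.unit) = (n == 1) || (n == -1) by [].
by lia.
Qed.

(** A non-constant [g] would satisfy [|g(b - 1)| < 1], hence vanish at [b - 1 >= 1], where the
    nonzero product with nonnegative coefficients is positive. *)
Lemma unit_factor_of_horner_unit (b : int) (g h : {poly int}) :
  2 <= b -> (forall i, 0 <= (g * h)`_i < b) -> g * h != 0 ->
  `|g.[b]| = 1 -> g \is a GRing.unit.
Proof.
move=> b2 digs gh0 gb.
have g0 : g != 0 by apply: contraNneq gh0 => ->; rewrite mul0r.
have [/eqP/size_poly1P[u u0 gE] | sg] := eqVneq (size g) 1%N.
  move: gb; rewrite gE hornerC poly_unitE size_polyC u0 coefC /= unitz_absz; lia.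
have {}sg : (1 < size g)%N by rewrite ltn_neqAle eq_sym sg size_poly_gt0.
have /(norm_horner_pred_lt sg) : forall z : algC,
    root (map_poly intr g) z -> 'Re z *+ 2 < (2 * b - 1)%:~R.
  move=> z gz; apply: (digits_root_Re b2 digs gh0).
  by rewrite rmorphM /= rootM gz.
rewrite gb => gb1; have gb0 : g.[b - 1] = 0 by move: (g.[b - 1]) gb1 => u; lia.
have : 0 < (g * h).[b - 1].
  by apply: horner_gt0 => // [i|]; [case/andP: (digs i) | lia].
by rewrite hornerM gb0 mul0r ltxx.
Qed.

Lemma irreducible_of_horner_prime (b p : nat) (f : {poly int}) :
  (1 < b)%N -> prime p -> (forall i, 0 <= f`_i < b%:Z) -> f.[b%:Z] = p%:Z ->
  poly_irreducibleZ f.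
Proof.
move=> b1 pr_p digs fb; have p1 := prime_gt1 pr_p.
have f0 : f != 0 by apply: contra_eq_neq fb => ->; rewrite horner0; lia.
split=> // [|g h fE].
  rewrite poly_unitE; apply/andP => -[/eqP/eqP/size_poly1P[u _ fE]].
  by move: fb; rewrite fE hornerC coefC /= unitz_absz => -> /eqP /= e; rewrite e in p1.
have /(congr1 absz) := fb; rewrite fE hornerM abszM => gh_p.
have : (absz g.[b%:Z] %| p)%N by rewrite -[p in X in (_ %| X)%N]gh_p dvdn_mulr.
rewrite fE in digs f0.
have b2 : 2 <= b%:Z by lia.
case/primeP: pr_p => _ prP /prP /orP[] /eqP gb.
  by left; apply: (unit_factor_of_horner_unit b2 digs f0); rewrite -abszE gb.
right; rewrite mulrC in digs f0; apply: (unit_factor_of_horner_unit b2 digs f0).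
suff h1 : absz h.[b%:Z] = 1%N by rewrite -abszE h1.
by move: gh_p; rewrite gb; move: (absz h.[_]) => k /=; nia.
Qed.

Lemma polyrep_irreducible b p : (1 < b)%N -> prime p ->
  poly_irreducibleZ (polyrep b p).
Proof.
move=> b1 pr_p; apply: (irreducible_of_horner_prime b1 pr_p).
  by move=> i; rewrite polyrep_coef_ge0 polyrep_coef_lt.
by rewrite polyrep_horner //; lia.
Qed.

Lemma lead_coef_polyrep1 n : (0 < n)%N -> lead_coef (polyrep 1 n) = 1.
Proof. by move=> n0; rewrite /lead_coef size_polyrep1 coef_polyrep1 prednK ?leqnn. Qed.

Lemma size1_factor_unit (g h : {poly int}) : lead_coef (g * h) = 1 ->
  size g = 1%N -> g \is a GRing.unit.
Proof.
rewrite lead_coefM => gh1 /eqP sg; rewrite poly_unitE sg /=.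
have -> : g`_0 = lead_coef g by rewrite /lead_coef (eqP sg).
by apply/unitrPr; exists (lead_coef h).
Qed.

(** Substituting [x + 1] in [x^n - 1 = f(x) (x - 1)] gives [f(x + 1) x + 1 = (x + 1)^n]. *)
Lemma coef_polyrep1_shift n i :
  (polyrep 1 n \Po ('X + 1%:P))`_i = 'C(n, i.+1)%:R.
Proof.
have : (polyrep 1 n \Po ('X + 1%:P)) * 'X + 1%:P = ('X + 1%:P) ^+ n.
  have fE : 'X^n - 1 = (polyrep 1 n) * ('X - 1%:P) :> {poly int}.
    rewrite subrX1 mulrC /polyrep eqxx poly_def; congr (_ * _).
    by apply: eq_bigr => j _; rewrite scale1r.
  have := congr1 (comp_poly ('X + 1%:P)) fE.
  rewrite comp_polyM !comp_polyB !comp_polyX comp_Xn_poly -!polyC1 !comp_polyC addrK.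
  by move/(canRL (subrK _)) => ->.
move/(congr1 (fun q : {poly int} => q`_i.+1)); rewrite coefMXaddCS => ->.
rewrite addrC exprDn coef_sum.
under eq_bigr => j _ do rewrite coefMn polyC1 expr1n mul1r coefXn.
have [i_lt | i_ge] := ltnP i.+1 n.+1.
  rewrite (bigD1 (Ordinal i_lt)) //= eqxx big1 ?addr0 // => j ji.
  by rewrite -val_eqE /= eq_sym in ji; rewrite (negPf ji) mul0rn.
rewrite bin_small // big1 // => j _.
by case: eqP => [e|_]; rewrite ?mul0rn //; have := ltn_ord j; lia.
Qed.

Lemma polyrep1_irreducible p : prime p -> poly_irreducibleZ (polyrep 1 p).
Proof.
move=> pr_p; have p1 := prime_gt1 pr_p; have p0 := prime_gt0 pr_p.
have f0 : polyrep 1 p != 0 by rewrite polyrep_eq0 -?lt0n.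
have sX : size ('X + 1%:P : {poly int}) = 2 by rewrite size_XaddC.
pose sh (q : {poly int}) := q \Po ('X + 1%:P).
have sz_sh q : size (sh q) = size q by rewrite size_comp_poly2.
have irr : irreducible_poly (sh (polyrep 1 p)).
  have coefE i : (sh (polyrep 1 p))`_i = 'C(p, i.+1)%:Z.
    by rewrite coef_polyrep1_shift natz.
  apply: (eisenstein_crit pr_p); rewrite ?sz_sh ?size_polyrep1.
  - by case: eqP p1 => // ->.
  - rewrite /lead_coef sz_sh size_polyrep1 coefE prednK // binn.
    by rewrite dvdzE /= dvdn1; lia.
  - by rewrite coefE bin1 dvdzE /= natrXE -[p in X in (_ %| X)%N]expn1 dvdn_Pexp2l.
  by move=> i i_lt; rewrite coefE dvdzE /= prime_dvd_bin //; lia.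
split=> // [|g h fE].
  by rewrite poly_unitE size_polyrep1; case: eqP p1 => // ->.
have lc1 := lead_coef_polyrep1 p0; rewrite fE in lc1.
have [/(size1_factor_unit lc1) | sg] := eqVneq (size g) 1%N; first by left.
right; rewrite mulrC in lc1; apply: size1_factor_unit lc1 _.
(* Eisenstein gives irreducibility up to constants: [g], of size other than 1, is associated to the
   whole product, so [h] is constant, and a unit because the product is monic. *)
have [_ /(_ (sh g))] := irr; rewrite sz_sh sg => /(_ isT).
rewrite {1}fE /sh comp_polyM dvdp_mulr // => /(_ isT)/eqp_size.
rewrite !sz_sh fE; move: f0; rewrite fE mulf_eq0 negb_or => /andP[g0 h0].
rewrite size_mul //; move: g0 h0; rewrite -!size_poly_gt0.
by move: (size g) (size h) => m n; lia.
Qed.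

Lemma polyrep_id n : (1 < n)%N -> polyrep n n = 'X.
Proof.
move=> n1; apply/esym/eq_polyrep; rewrite ?hornerX //.
by move=> i; rewrite coefX; case: eqP; lia.
Qed.

Lemma polyrep_positive b c : (0 < b)%N -> (0 < c)%N -> poly_positive (polyrep b c).
Proof.
move=> b0 c0; rewrite /poly_positive lt0r lead_coef_eq0 polyrep_eq0 // -lt0n c0.
exact: polyrep_coef_ge0.
Qed.

Lemma coef0_polyrep b c : (1 < b)%N -> (0 < c)%N -> (polyrep b c)`_0 = (c %% b)%:Z.
Proof.
move=> b1 c0; rewrite /polyrep; case: eqP => [e | _]; first by lia.
by rewrite coef_poly c0 /base_digit expn0 divn1.
Qed.

(** For properness, a common divisor of the values divides the value [p] at [b]. Modulus [p] is
    excluded by the value 1 at 1 if [b = p], and otherwise by the value at 0, which is 1 if [b = 1]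
    and the nonzero remainder of [p] modulo [b] if not. *)
Lemma polyrep_PPI b p : prime p -> (0 < b <= p)%N -> PPI (polyrep b p).
Proof.
move=> pr_p /andP[b0 bp]; have p1 := prime_gt1 pr_p; have p0 := prime_gt0 pr_p.
split; first exact: polyrep_positive.
  split=> [|d d_dvd]; first by rewrite size_polyrep_gt1 ?b0.
  rewrite unitz_absz; have := d_dvd b%:Z; rewrite polyrep_horner // dvdzE /=.
  case/primeP: (pr_p) => _ prP /prP /orP[// | /eqP d_p]; exfalso.
  have p_dvd n : (p %| absz (polyrep b p).[n])%N by have := d_dvd n; rewrite dvdzE d_p.
  have [bp_eq | b_neq] := eqVneq b p.
    by have := p_dvd 1; rewrite bp_eq polyrep_id // hornerX dvdn1; lia.
  have := p_dvd 0; rewrite horner_coef0; have [b1 | b1] := eqVneq b 1%N.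
    by rewrite b1 coef_polyrep1 p0 dvdn1; lia.
  rewrite coef0_polyrep //; last by lia.
  have [pb | pb] := posnP (p %% b).
    have : (b %| p)%N by rewrite /dvdn pb.
    by move/prP; rewrite (negPf b1) (negPf b_neq).
  by move/(dvdn_leq pb); have := ltn_pmod p b0; lia.
have [-> | b1] := eqVneq b 1%N; first exact: polyrep1_irreducible.
by apply: polyrep_irreducible => //; lia.
Qed.

(** The difference has coefficients of modulus below [b'], so its sign is read off at [b'], where
    the first polynomial, being non-constant, exceeds its value [c] at [b]. *)
Lemma polyrep_gt b b' c : (0 < b < b')%N -> (b <= c)%N -> (1 < c)%N ->
  poly_gt (polyrep b c) (polyrep b' c).
Proof.
move=> /andP[b0 bb'] bc c1; apply: (@lead_gt0_horner b'%:Z).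
  move=> i; rewrite coefB.
  have : (polyrep b c)`_i < b'%:Z.
    have [-> | b1] := eqVneq b 1%N; last first.
      by apply: lt_trans (polyrep_coef_lt _ _ _) _; lia.
    by rewrite coef_polyrep1; case: (_ < _)%N; lia.
  have := polyrep_coef_lt c i (leq_ltn_trans b0 bb' : (1 < b')%N); have := polyrep_coef_ge0 b c i.
  have := polyrep_coef_ge0 b' c i.
  by move: ((polyrep b c)`_i) ((polyrep b' c)`_i) => u v; lia.
rewrite hornerD hornerN subr_gt0 polyrep_horner; last by lia.
rewrite -(polyrep_horner c b0); apply: horner_lt; rewrite ?size_polyrep_gt1 ?b0 //.
exact: polyrep_coef_ge0.
Qed.

(** In (1), a base above [c] yields the constant [c], which is not proper, so only positivity and
    irreducibility are claimed there. In (5), [c > 1] is assumed because all representatives of 1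
    are the constant 1. *)
Theorem proposition2 (a b c : nat) (f : {poly int})
    (ha : (0 < a)%N) (hb : (0 < b)%N) (hc : (0 < c)%N)
    (hf : [/\ (2 <= b)%N, f != 0, (forall i : nat, 0 <= f`_i <= b%:Z - 1)
            & f.[b%:Z] = c%:Z]
          \/ (b = 1%N /\ f = ('X^c - 1) %/ ('X - 1))) :
  f = polyrep b c /\
  (* (1) *)
  (prime c -> forall b' : nat, (0 < b')%N ->
     ((b' <= c)%N -> PPI (polyrep b' c)) /\
     ((c < b')%N -> poly_positive (polyrep b' c) /\
                    poly_irreducibleZ (polyrep b' c))) /\
  (* (2) *)
  ((a < b)%N ->
     (forall i : nat, (i < size (f \Po ('X + (a%:Z)%:P)))%N ->
        0 < (f \Po ('X + (a%:Z)%:P))`_i) /\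
     (forall g : {poly int}, descent a (b - a) f g <-> g = polyrep (b - a) c)) /\
  (* (3) *)
  (forall g : {poly int}, ascent a (b + a) f g <-> g = polyrep (b + a) c) /\
  (* (4) *)
  (((a < b)%N -> forall h : {poly int},
      (exists2 g : {poly int}, descent a (b - a) f g & ascent a b g h) <-> h = f) /\
   (forall h : {poly int},
      (exists2 g : {poly int}, ascent a (b + a) f g & descent a b g h) <-> h = f)) /\
  (* (5) *)
  (forall b' : nat, (b < b')%N ->
     ((b <= c)%N -> (1 < c)%N -> poly_gt (polyrep b c) (polyrep b' c)) /\
     ((c < b)%N -> polyrep b c = (c%:Z)%:P /\ polyrep b' c = (c%:Z)%:P)).
Proof.
have fE : f = polyrep b c.
  case: hf => [[b1 _ digs fb] | [-> ->]]; last exact: polyrep1E.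
  by apply: eq_polyrep => // i; have := digs i; move: (f`_i) => u; lia.
have f_ge0 i : 0 <= f`_i by rewrite fE polyrep_coef_ge0.
have fb : f.[b%:Z] = c%:Z by rewrite fE polyrep_horner.
have desc : (a < b)%N -> forall g, descent a (b - a) f g <-> g = polyrep (b - a) c.
  move=> ab g; apply: descentE => //; first by lia.
  by rewrite subnKC ?fb //; lia.
have asc g : ascent a (b + a) f g <-> g = polyrep (b + a) c.
  by apply: ascentE => //; [lia | rewrite PoszD addrK].
have asc_back : (a < b)%N -> forall h,
    ascent a b (polyrep (b - a) c) h <-> h = f.
  move=> ab h; rewrite fE; apply: ascentE => //; first by lia.
  by rewrite subzn ?polyrep_horner //; lia.
have desc_back h : descent a b (polyrep (b + a) c) h <-> h = f.
  rewrite fE; apply: descentE => //; first exact: polyrep_coef_ge0.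
  by rewrite addnC polyrep_horner //; lia.
split=> //; split.
  move=> pr_c b' b'0; split=> [b'c | cb']; first by apply: polyrep_PPI; rewrite ?b'0.
  split; first exact: polyrep_positive.
  by apply: polyrep_irreducible => //; lia.
split.
  by move=> ab; split; [exact: (coef_shift_gt0 (a := a%:Z)) | exact: desc].
split=> //; split; [split |].
- move=> ab h; rewrite -asc_back //; split=> [[g /(desc ab) ->] // | fh].
  by exists (polyrep (b - a) c) => //; apply/desc.
- move=> h; rewrite -desc_back; split=> [[g /asc ->] // | fh].
  by exists (polyrep (b + a) c) => //; apply/asc.
move=> b' bb'; split=> [bc c1 | cb]; first by apply: polyrep_gt; rewrite ?hb.
by split; apply: polyrep_small => //; lia.
Qed.
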